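(* Let $(M_1\times_f M_2,F)$ be a flat twisted product Finsler manifold and suppose $(M_1,F_1)$ is Riemannian. If $f$ is a function on $M_2$ only, then $(M_1,F_1)$ is locally flat.
   Context: Let $(M_1,F_1)$, $(M_2,F_2)$ be Finsler manifolds (metrics smooth on the slit tangent bundle, positively 1-homogeneous on fibres, with positive definite fundamental tensor) and $f:M_1\times M_2\to\mathbb{R}^+$ smooth. The twisted product $M_1\times_f M_2$ is $M=M_1\times M_2$ with $F=\sqrt{F_1^2(x,y)+f^2(x,u)F_2^2(u,v)}$, considered where $y\ne0$, $v\ne 0$. Local coordinates are $\mathbf{x}^a=(x^i,u^\alpha)$ with fibre coordinates $\mathbf{y}^a=(y^i,v^\alpha)$. Put $\mathbf g_{ab}=\frac12\frac{\partial^2F^2}{\partial\mathbf y^a\partial\mathbf y^b}$, spray coefficients $\mathbf G^a=\frac14\mathbf g^{ab}\big(\frac{\partial^2F^2}{\partial\mathbf y^b\partial\mathbf x^c}\mathbf y^c-\frac{\partial F^2}{\partial\mathbf x^b}\big)$, $\mathbf G^a_b=\frac{\partial\mathbf G^a}{\partial\mathbf y^b}$, $\frac{\delta^t}{\delta^t\mathbf x^a}=\frac{\partial}{\partial\mathbf x^a}-\mathbf G^b_a\frac{\partial}{\partial\mathbf y^b}$, and $$\mathbf F^c_{ab}=\tfrac12\mathbf g^{ce}\Big(\frac{\delta^t\mathbf g_{ea}}{\delta^t\mathbf x^b}+\frac{\delta^t\mathbf g_{eb}}{\delta^t\mathbf x^a}-\frac{\delta^t\mathbf g_{ab}}{\delta^t\mathbf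 x^e}\Big),\qquad \mathbf R^{\ a}_{b\ cd}=\frac{\delta^t\mathbf F^a_{bc}}{\delta^t\mathbf x^d}-\frac{\delta^t\mathbf F^a_{bd}}{\delta^t\mathbf x^c}+\mathbf F^a_{de}\mathbf F^e_{bc}-\mathbf F^a_{ce}\mathbf F^e_{bd}.$$ $(M_1\times_fM_2,F)$ is flat if $\mathbf R^{\ a}_{b\ cd}=0$. A Riemannian manifold is locally flat if its Riemann curvature tensor vanishes. ''$f$ is a function on $M_2$ only'' means $\partial f/\partial x^i=0$. *)

(* Defs.v *)
From HB Require Import structures.
From mathcomp Require Import all_boot all_order all_algebra.
From mathcomp Require Import all_classical all_reals all_analysis.

Set Implicit Arguments.
Unset Strict Implicit.
Unset Printing Implicit Defensive.

Import Order.TTheory GRing.Theory Num.Theory.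
Import numFieldNormedType.Exports.

Local Open Scope classical_set_scope.
Local Open Scope ring_scope.

Section Smooth.
Context {R : realType} {V W : normedModType R}.

(* C^k on an open set through directional derivatives; in finite dimension, the
   only case used below, this is the usual notion: taking v among the basis
   vectors gives existence and continuity of all iterated partials. *)
Fixpoint Ck_on (k : nat) (U : set V) (f : V -> W) : Prop :=
  (forall x, U x -> {for x, continuous f}) /\
  if k is k'.+1 then
    forall v, (forall x, U x -> derivable f x v) /\ Ck_on k' U ('D_v f)
  else True.

Definition smooth_on (U : set V) (f : V -> W) := forall k, Ck_on k U f.

End Smooth.

Section Manifold.
Context {R : realType}.

(* [cmap] and [cinv] are total functions, meaningful only on [cdom] and [cimg]. *)
Record chart (M : topologicalType) (n : nat) := Chart {
  cdom : set M;
  cimg : set 'rV[R]_n;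
  cmap : M -> 'rV[R]_n;
  cinv : 'rV[R]_n -> M;
  cdom_open : open cdom;
  cimg_open : open cimg;
  cmap_img : forall p, cdom p -> cimg (cmap p);
  cinv_dom : forall x, cimg x -> cdom (cinv x);
  cmapK : forall p, cdom p -> cinv (cmap p) = p;
  cinvK : forall x, cimg x -> cmap (cinv x) = x;
  cmap_continuous : {within cdom, continuous cmap};
  cinv_continuous : {within cimg, continuous cinv} }.

Section Transition.
Context {M : topologicalType} {n : nat}.
Implicit Types c d : chart M n.

Definition overlap c d : set 'rV[R]_n :=
  [set x | cimg c x /\ cdom d (cinv c x)].

Definition transition c d : 'rV[R]_n -> 'rV[R]_n :=
  fun x => cmap d (cinv c x).

End Transition.

Record manifold (n : nat) := Manifold {
  space :> topologicalType;
  space_hausdorff : hausdorff_space space;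
  space_second_countable : @second_countable space;
  space_nonempty : [set: space] !=set0;
  chart_index : Type;
  charts : chart_index -> chart space n;
  charts_cover : forall p : space, exists i, cdom (charts i) p;
  charts_compatible : forall i j,
    smooth_on (overlap (charts i) (charts j))
              (transition (charts i) (charts j)) }.

End Manifold.

Arguments chart R M n : clear implicits.
Arguments manifold R n : clear implicits.

(* The geometric objects of one coordinate domain of R^N, as functions of the
   position x and the fibre coordinate y. Derivatives and inverse matrices are
   the library's total operations. *)
Section LocalFinsler.
Context {R : realType} {N : nat}.
Implicit Types (H F : 'rV[R]_N -> 'rV[R]_N -> R) (a b c d : 'I_N)
  (x y : 'rV[R]_N).

Definition pdx a H x y : R := 'D_(delta_mx 0 a) (H^~ y) x.
Definition pdy a H x y : R := 'D_(delta_mx 0 a) (H x) y.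

Definition energy F x y : R := F x y ^+ 2.

Definition fund_tensor F x y : 'M[R]_N :=
  \matrix_(a, b) (2^-1 * pdy a (pdy b (energy F)) x y).

Definition spray F a x y : R :=
  4^-1 * \sum_b invmx (fund_tensor F x y) a b *
    ((\sum_c pdy b (pdx c (energy F)) x y * y 0 c) - pdx b (energy F) x y).

(* [nonlinear_conn F a b] is G^a_b. *)
Definition nonlinear_conn F a b : 'rV[R]_N -> 'rV[R]_N -> R :=
  pdy b (spray F a).

(* [hderiv F a] is delta / delta x^a. *)
Definition hderiv F a H x y : R :=
  pdx a H x y - \sum_b nonlinear_conn F b a x y * pdy b H x y.

Definition fund_coef F a b x y : R := fund_tensor F x y a b.

(* [hconn F c a b] is F^c_{ab}. *)
Definition hconn F c a b x y : R :=
  2^-1 * \sum_e invmx (fund_tensor F x y) c e *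
    (hderiv F b (fund_coef F e a) x y + hderiv F a (fund_coef F e b) x y
     - hderiv F e (fund_coef F a b) x y).

(* [hcurv F a b c d] is R_b^a_{cd}. *)
Definition hcurv F a b c d x y : R :=
  hderiv F d (hconn F a b c) x y - hderiv F c (hconn F a b d) x y
  + (\sum_e hconn F a d e x y * hconn F e b c x y)
  - (\sum_e hconn F a c e x y * hconn F e b d x y).

End LocalFinsler.

Section LocalRiemann.
Context {R : realType} {n : nat}.
Implicit Types (g : 'rV[R]_n -> 'M[R]_n) (i j k l : 'I_n) (x : 'rV[R]_n).

Definition bilin (A : 'M[R]_n) (y w : 'rV[R]_n) : R :=
  (y *m A *m w^T) 0 0.

Definition pd i (h : 'rV[R]_n -> R) x : R := 'D_(delta_mx 0 i) h x.

(* [christoffel g k i j] is Gamma^k_{ij}. *)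
Definition christoffel g k i j x : R :=
  2^-1 * \sum_l invmx (g x) k l *
    (pd j (fun z => g z l i) x + pd i (fun z => g z l j) x
     - pd l (fun z => g z i j) x).

(* [riemann_curv g i j k l] is R_j^i_{kl}, with the sign convention of [hcurv]. *)
Definition riemann_curv g i j k l x : R :=
  pd l (christoffel g i j k) x - pd k (christoffel g i j l) x
  + (\sum_m christoffel g i l m x * christoffel g m j k x)
  - (\sum_m christoffel g i k m x * christoffel g m j l x).

End LocalRiemann.

(* Functions on the tangent bundle and tensor fields are given by their
   expressions in the charts, subject to the transformation law: a tangent
   vector with coordinates y at x in chart i has coordinates 'D_y tau x in
   chart j, where tau is the transition map. *)
Section Structures.
Context {R : realType} {n : nat} (M : manifold R n).

Record finsler := Finsler {
  fnorm :> chart_index M -> 'rV[R]_n -> 'rV[R]_n -> R;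
  fnorm_compatible : forall i j x y,
    overlap (charts i) (charts j) x ->
    let tau := transition (charts i) (charts j) in
    fnorm j (tau x) ('D_y tau x) = fnorm i x y;
  fnorm_ge0 : forall i x y, cimg (charts i) x -> 0 <= fnorm i x y;
  fnorm_smooth : forall i,
    smooth_on [set p : 'rV[R]_n * 'rV[R]_n | cimg (charts i) p.1 /\ p.2 != 0]
              (fun p => fnorm i p.1 p.2);
  fnorm_homogeneous : forall i x y (t : R), cimg (charts i) x -> 0 < t ->
    fnorm i x (t *: y) = t * fnorm i x y;
  fnorm_posdef : forall i x y w, cimg (charts i) x -> y != 0 -> w != 0 ->
    0 < bilin (fund_tensor (fnorm i) x y) w w }.

Record riemannian_metric := RiemannianMetric {
  rmetric :> chart_index M -> 'rV[R]_n -> 'M[R]_n;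
  rmetric_compatible : forall i j x y w,
    overlap (charts i) (charts j) x ->
    let tau := transition (charts i) (charts j) in
    bilin (rmetric j (tau x)) ('D_y tau x) ('D_w tau x)
      = bilin (rmetric i x) y w;
  rmetric_smooth : forall i k l,
    smooth_on (cimg (charts i)) (fun x => rmetric i x k l);
  rmetric_sym : forall i x, cimg (charts i) x ->
    (rmetric i x)^T = rmetric i x;
  rmetric_posdef : forall i x w, cimg (charts i) x -> w != 0 ->
    0 < bilin (rmetric i x) w w }.

(* (M, F) is Riemannian, with metric tensor g. Such a g is determined by F on
   the coordinate domains, by polarization. *)
Definition is_riemannian (F : finsler) (g : riemannian_metric) :=
  forall i x y, cimg (charts i) x -> F i x y = Num.sqrt (bilin (g i x) y y).

Definition locally_flat (g : riemannian_metric) :=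
  forall i x, cimg (charts i) x ->
  forall a b c d, riemann_curv (g i) a b c d x = 0.

End Structures.

Section Twisted.
Context {R : realType} {n1 n2 : nat} {M1 : manifold R n1} {M2 : manifold R n2}.
Implicit Types (f : M1 * M2 -> R)
  (i : chart_index M1) (j : chart_index M2).

(* The expression f(x, u) of f in a product chart. *)
Definition local_expr f i j (x : 'rV[R]_n1) (u : 'rV[R]_n2) : R :=
  f (cinv (charts i) x, cinv (charts j) u).

Definition smooth_function f := forall i j,
  smooth_on [set p : 'rV[R]_n1 * 'rV[R]_n2 |
              cimg (charts i) p.1 /\ cimg (charts j) p.2]
            (fun p => local_expr f i j p.1 p.2).

(* [bx] and [by_] are (x, u) and (y, v) as vectors of R^(n1 + n2). *)
Definition twisted_norm (F1 : finsler M1) (F2 : finsler M2) f i j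
    (bx by_ : 'rV[R]_(n1 + n2)) : R :=
  let x := lsubmx bx in let u := rsubmx bx in
  let y := lsubmx by_ in let v := rsubmx by_ in
  Num.sqrt (F1 i x y ^+ 2 + local_expr f i j x u ^+ 2 * F2 j u v ^+ 2).

Definition flat_twisted_product (F1 : finsler M1) (F2 : finsler M2) f :=
  forall i j x u y v,
    cimg (charts i) x -> cimg (charts j) u -> y != 0 -> v != 0 ->
  forall a b c d,
    hcurv (twisted_norm F1 F2 f i j) a b c d (row_mx x u) (row_mx y v) = 0.

Definition depends_on_second_only f :=
  forall i j x u, cimg (charts i) x -> cimg (charts j) u ->
  forall k, pd k ((local_expr f i j)^~ u) x = 0.

End Twisted.

(* Main.v *)
Require Import Defs.
From mathcomp Require Import all_boot all_order all_algebra.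
From mathcomp Require Import all_classical all_reals all_analysis.
From mathcomp Require Import ring.

(** The fundamental tensor of the twisted product is block diagonal, and since
    [F1] is Riemannian its upper block is [g1 x], which depends neither on [u]
    nor on the fibre coordinates. Hence the nonlinear connection drops out of
    the horizontal derivatives of the base components, [F^i_{jk}] is the
    Christoffel symbol of [g1], the mixed coefficients [F^i_{j alpha}] vanish,
    and the base components of the curvature are the Riemann curvature of
    [g1]. *)

Set Implicit Arguments.
Unset Strict Implicit.
Unset Printing Implicit Defensive.

Import Order.TTheory GRing.Theory Num.Theory.
Import numFieldNormedType.Exports.

Local Open Scope classical_set_scope.
Local Open Scope ring_scope.

(** * Directional derivatives determined by values along a line *)

Section DirectionalDerivative.
Context {R : realType}.

Lemma near_quotient_eq (V V' W : normedModType R) (f : V -> W) (g : V' -> W)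
    (x v : V) (x' v' : V') :
  (\forall h \near (0 : R), f (h *: v + x) = g (h *: v' + x')) ->
  {near 0^', (fun h => h^-1 *: ((f \o shift x) (h *: v) - f x)) =1
             (fun h => h^-1 *: ((g \o shift x') (h *: v') - g x'))}.
Proof.
(* The neighbourhood of 0 is not punctured, so [h = 0] also gives [f x = g x']. *)
move=> fg; have := nbhs_singleton fg; rewrite !scale0r !add0r => fg0.
by apply: nbhs_dnbhs; near=> h => /=; rewrite fg0; congr (_ *: (_ - _)); near: h.
Unshelve. all: by end_near. Qed.

(** [lim] sees only the filter of difference quotients, so the values agree whether or not the
    limits exist. Two source spaces are allowed so that a derivative on a product can be compared
    with one on a factor. *)
Lemma near_derive_eq (V V' W : normedModType R) (f : V -> W) (g : V' -> W)
    (x v : V) (x' v' : V') :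
  (\forall h \near (0 : R), f (h *: v + x) = g (h *: v' + x')) ->
  'D_v f x = 'D_v' g x'.
Proof.
move=> fg; congr (lim _); rewrite eqEsubset; split.
  exact: near_eq_cvg (near_quotient_eq fg).
by apply: near_eq_cvg; apply: filterS (near_quotient_eq fg) => h ->.
Qed.

Lemma near_derivable_eq (V V' W : normedModType R) (f : V -> W) (g : V' -> W)
    (x v : V) (x' v' : V') :
  (\forall h \near (0 : R), f (h *: v + x) = g (h *: v' + x')) ->
  derivable f x v -> derivable g x' v'.
Proof.
move=> fg /cvg_ex[l fl]; apply/cvg_ex; exists l; apply: cvg_trans fl.
by apply: near_eq_cvg; apply: filterS (near_quotient_eq fg) => h ->.
Qed.

Lemma near_line (V : normedModType R) (U : set V) (x v : V) :
  open U -> U x -> \forall h \near (0 : R), U (h *: v + x).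
Proof.
move=> oU Ux.
have cl : h *: v + x @[h --> (0 : R)] --> x.
  rewrite -[X in _ --> X]add0r -[X in _ --> X + _](scale0r v).
  by apply: cvgD; [apply: cvgZr_tmp; exact: cvg_id | exact: cvg_cst].
by apply: cl; apply: open_nbhs_nbhs.
Qed.

(** The difference quotient is exactly [a + h * b] for nonzero [h], so existence of the limit need
    not be assumed. *)
Lemma derive_of_quadratic (V : normedModType R) (f : V -> R) (x v : V) (a b : R) :
  (forall h, f (h *: v + x) = f x + h * a + h ^+ 2 * b) -> 'D_v f x = a.
Proof.
move=> fE; apply: cvg_lim => //.
have cl : a + h * b @[h --> (0 : R)^'] --> a.
  rewrite -[X in _ --> X]addr0 -[X in _ --> _ + X](mul0r b).
  apply: cvg_within_filter; apply: cvgD; first exact: cvg_cst.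
  by apply: cvgM; [exact: cvg_id | exact: cvg_cst].
apply: cvg_trans cl; apply: near_eq_cvg; near=> h => /=.
have h0 : h != 0 by near: h; exact: nbhs_dnbhs_neq.
rewrite fE /GRing.scale /=.
have -> : f x + h * a + h ^+ 2 * b - f x = h * (a + h * b) by ring.
by rewrite mulKf.
Unshelve. all: by end_near. Qed.

Lemma derive_constant_on_line (V : normedModType R) (f : V -> R) (x v : V) :
  (forall h, f (h *: v + x) = f x) -> 'D_v f x = 0.
Proof.
move=> fE; apply: (@derive_of_quadratic _ _ _ _ _ 0) => h.
by rewrite fE !mulr0 !addr0.
Qed.

End DirectionalDerivative.

(** * Bilinear forms of matrices *)

Section Bilin.
Context {R : realType} {n : nat}.
Implicit Types (A : 'M[R]_n) (y w : 'rV[R]_n).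

Lemma bilinDl A y y' w : bilin A (y + y') w = bilin A y w + bilin A y' w.
Proof. by rewrite /bilin !mulmxDl mxE. Qed.

Lemma bilinDr A y w w' : bilin A y (w + w') = bilin A y w + bilin A y w'.
Proof. by rewrite /bilin linearD mulmxDr mxE. Qed.

Lemma bilinZl A (t : R) y w : bilin A (t *: y) w = t * bilin A y w.
Proof. by rewrite /bilin -!scalemxAl mxE. Qed.

Lemma bilinZr A (t : R) y w : bilin A y (t *: w) = t * bilin A y w.
Proof. by rewrite /bilin linearZ -scalemxAr mxE. Qed.

Lemma bilin_delta A i j : bilin A (delta_mx 0 i) (delta_mx 0 j) = A i j.
Proof. by rewrite /bilin trmx_delta -rowE -colE !mxE. Qed.

(** A nonzero [w] with [w *m A = 0] would give [bilin A w w = 0]. *)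
Lemma posdef_unitmx A : (forall w, w != 0 -> 0 < bilin A w w) -> A \in unitmx.
Proof.
move=> A_gt0; rewrite -row_free_unit -kermx_eq0; apply/rowV0P => w.
move=> /sub_kermxP wA; apply/eqP; apply: contraT => /A_gt0.
by rewrite /bilin wA mul0mx mxE ltxx.
Qed.

End Bilin.

(** * Coordinate lines in a product *)

Section ShiftLine.
Context {R : realType} {n1 n2 : nat}.
Implicit Types (h : R) (z : 'rV[R]_(n1 + n2)).

Lemma lsubmx_line_lshift h (k : 'I_n1) z :
  lsubmx (h *: delta_mx 0 (lshift n2 k) + z) = h *: delta_mx 0 k + lsubmx z.
Proof. by rewrite delta_mx_lshift linearD linearZ /= row_mxKl. Qed.

Lemma rsubmx_line_lshift h (k : 'I_n1) z :
  rsubmx (h *: delta_mx 0 (lshift n2 k) + z) = rsubmx z.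
Proof. by rewrite delta_mx_lshift linearD linearZ /= row_mxKr scaler0 add0r. Qed.

Lemma lsubmx_line_rshift h (k : 'I_n2) z :
  lsubmx (h *: delta_mx 0 (rshift n1 k) + z) = lsubmx z.
Proof. by rewrite delta_mx_rshift linearD linearZ /= row_mxKl scaler0 add0r. Qed.

Lemma rsubmx_line_rshift h (k : 'I_n2) z :
  rsubmx (h *: delta_mx 0 (rshift n1 k) + z) = h *: delta_mx 0 k + rsubmx z.
Proof. by rewrite delta_mx_rshift linearD linearZ /= row_mxKr. Qed.

Definition line_shiftE := (lsubmx_line_lshift, rsubmx_line_lshift,
  lsubmx_line_rshift, rsubmx_line_rshift).

End ShiftLine.

(** * Connection and curvature for a block diagonal fundamental tensor *)

Section BlockDiagonalFundTensor.
Context {R : realType} {n1 n2 : nat}.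
Variables (F : 'rV[R]_(n1 + n2) -> 'rV[R]_(n1 + n2) -> R).
Variables (U1 : set 'rV[R]_n1) (U2 V2 : set 'rV[R]_n2).
Variables (g : 'rV[R]_n1 -> 'M[R]_n1).
Variables (g2 : 'rV[R]_(n1 + n2) -> 'rV[R]_(n1 + n2) -> 'M[R]_n2).

(** In the application [V2] consists of the nonzero vectors. The first fibre component is left free:
    a Riemannian energy is quadratic in it, also at 0. *)
Definition split_domain (x y : 'rV[R]_(n1 + n2)) :=
  [/\ U1 (lsubmx x), U2 (rsubmx x) & V2 (rsubmx y)].

Hypotheses (oU1 : open U1) (oU2 : open U2) (oV2 : open V2).
Hypothesis F_block : forall x y, split_domain x y ->
  fund_tensor F x y = block_mx (g (lsubmx x)) 0 0 (g2 x y).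
Hypothesis F_unit : forall x y, split_domain x y -> fund_tensor F x y \in unitmx.

(** Openness keeps short coordinate segments inside the domain, so identities valid only there can
    still be differentiated. *)
Lemma near_split_domain_x x y a : split_domain x y ->
  \forall h \near (0 : R), split_domain (h *: delta_mx 0 a + x) y.
Proof.
move=> [Ux Uu Vv]; rewrite -(fintype.splitK a).
case: (fintype.split a) => k /=; near=> h; split;
  rewrite ?line_shiftE //; near: h; exact: near_line.
Unshelve. all: by end_near. Qed.

Lemma near_split_domain_y x y a : split_domain x y ->
  \forall h \near (0 : R), split_domain x (h *: delta_mx 0 a + y).
Proof.
move=> [Ux Uu Vv]; rewrite -(fintype.splitK a).
case: (fintype.split a) => k /=; near=> h; split;
  rewrite ?line_shiftE //; near: h; exact: near_line.
Unshelve. all: by end_near. Qed.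

Section BaseFunction.
Variables (H : 'rV[R]_(n1 + n2) -> 'rV[R]_(n1 + n2) -> R) (h1 : 'rV[R]_n1 -> R).
Hypothesis H_base : forall x y, split_domain x y -> H x y = h1 (lsubmx x).

Lemma pdy_base x y a : split_domain x y -> pdy a H x y = 0.
Proof.
move=> Dxy; rewrite -(derive_cst (h1 (lsubmx x)) y (delta_mx 0 a)).
apply: near_derive_eq; apply: filterS (near_split_domain_y a Dxy) => h.
exact: H_base.
Qed.

(** The nonlinear connection enters only as a factor of fibre derivatives of [H], which vanish; the
    spray is never computed. *)
Lemma hderiv_base x y a : split_domain x y -> hderiv F a H x y = pdx a H x y.
Proof.
move=> Dxy; rewrite /hderiv big1 ?subr0 // => b _.
by rewrite pdy_base // mulr0.
Qed.

Lemma hderiv_base_lshift x y k : split_domain x y ->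
  hderiv F (lshift n2 k) H x y = pd k h1 (lsubmx x).
Proof.
move=> Dxy; rewrite hderiv_base //; apply: near_derive_eq.
apply: filterS (near_split_domain_x (lshift n2 k) Dxy) => h Dh.
by rewrite H_base // line_shiftE.
Qed.

Lemma hderiv_base_rshift x y k : split_domain x y ->
  hderiv F (rshift n1 k) H x y = 0.
Proof.
move=> Dxy; rewrite hderiv_base //.
rewrite -(derive_cst (h1 (lsubmx x)) x (delta_mx 0 (rshift n1 k))).
apply: near_derive_eq.
apply: filterS (near_split_domain_x (rshift n1 k) Dxy) => h Dh.
by rewrite H_base // line_shiftE.
Qed.

End BaseFunction.

Lemma hderiv_const0 H x y a : (forall x y, split_domain x y -> H x y = 0) ->
  split_domain x y -> hderiv F a H x y = 0.
Proof.
move=> H0 Dxy; rewrite (@hderiv_base _ (fun=> 0)) //.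
rewrite -(derive_cst (0 : R) x (delta_mx 0 a)); apply: near_derive_eq.
by apply: filterS (near_split_domain_x a Dxy) => h Dh; rewrite H0.
Qed.

Lemma fund_coef_ll x y i j : split_domain x y ->
  fund_coef F (lshift n2 i) (lshift n2 j) x y = g (lsubmx x) i j.
Proof. by move=> Dxy; rewrite /fund_coef F_block // block_mxEul. Qed.

Lemma fund_coef_lr x y i j : split_domain x y ->
  fund_coef F (lshift n2 i) (rshift n1 j) x y = 0.
Proof. by move=> Dxy; rewrite /fund_coef F_block // block_mxEur mxE. Qed.

(** The inverse of a block diagonal matrix is block diagonal, so raising to a first-factor index
    sums over first-factor indices only. *)
Lemma hconn_lE x y i a b : split_domain x y ->
  hconn F (lshift n2 i) a b x y =
  2^-1 * \sum_l invmx (g (lsubmx x)) i l *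
    (hderiv F b (fund_coef F (lshift n2 l) a) x y
     + hderiv F a (fund_coef F (lshift n2 l) b) x y
     - hderiv F (lshift n2 l) (fund_coef F a b) x y).
Proof.
move=> Dxy; rewrite /hconn F_block // invmx_block_diag; last first.
  by rewrite -F_block // F_unit.
congr (_ * _); rewrite big_split_ord /= [X in _ + X]big1 ?addr0.
  by apply: eq_bigr => l _; rewrite block_mxEul.
by move=> l _; rewrite block_mxEur mxE mul0r.
Qed.

Lemma hconn_lll x y i j k : split_domain x y ->
  hconn F (lshift n2 i) (lshift n2 j) (lshift n2 k) x y
  = christoffel g i j k (lsubmx x).
Proof.
move=> Dxy; rewrite hconn_lE //; congr (_ * _); apply: eq_bigr => l _.
have hE p q m : hderiv F (lshift n2 p) (fund_coef F (lshift n2 q) (lshift n2 m)) x y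
    = pd p (fun z => g z q m) (lsubmx x).
  by apply: hderiv_base_lshift => // x' y' D'; exact: fund_coef_ll.
by rewrite !hE.
Qed.

(** One term differentiates [g] in a second-factor direction; the other two differentiate
    off-diagonal entries, which are zero. *)
Lemma hconn_llr x y i j k : split_domain x y ->
  hconn F (lshift n2 i) (lshift n2 j) (rshift n1 k) x y = 0.
Proof.
move=> Dxy; rewrite hconn_lE // big1 ?mulr0 // => l _.
rewrite (@hderiv_base_rshift _ (fun z => g z l j)) //; last first.
  by move=> x' y' D'; exact: fund_coef_ll.
rewrite !hderiv_const0 ?addr0 ?subr0 ?mulr0 // => x' y' D'; exact: fund_coef_lr.
Qed.

Lemma hcurv_base x y i j k l : split_domain x y ->
  hcurv F (lshift n2 i) (lshift n2 j) (lshift n2 k) (lshift n2 l) x y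
  = riemann_curv g i j k l (lsubmx x).
Proof.
move=> Dxy; rewrite /hcurv /riemann_curv !big_split_ord /=.
have hE p q m r : hderiv F (lshift n2 r)
    (hconn F (lshift n2 p) (lshift n2 q) (lshift n2 m)) x y
    = pd r (christoffel g p q m) (lsubmx x).
  by apply: hderiv_base_lshift => // x' y' D'; exact: hconn_lll.
(* For a second-factor summation index the left factor already vanishes, so the coefficients with
   second-factor upper index are never computed. *)
have sum0 p q m r : \sum_(e < n2) hconn F (lshift n2 p) (lshift n2 q) (rshift n1 e) x y
    * hconn F (rshift n1 e) (lshift n2 m) (lshift n2 r) x y = 0.
  by rewrite big1 // => e _; rewrite hconn_llr // mul0r.
rewrite !hE !sum0 !addr0.
by congr (_ + _ - _); apply: eq_bigr => e _; rewrite !hconn_lll.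
Qed.

End BlockDiagonalFundTensor.

(** * Fundamental tensor of an energy that splits along the fibre *)

Section SplitEnergy.
Context {R : realType} {n1 n2 : nat}.
Variables (F : 'rV[R]_(n1 + n2) -> 'rV[R]_(n1 + n2) -> R).
Variables (A : 'M[R]_n1) (K : 'rV[R]_n2 -> R) (x : 'rV[R]_(n1 + n2)).
Hypothesis A_sym : A^T = A.
Hypothesis F_split : forall y,
  energy F x y = bilin A (lsubmx y) (lsubmx y) + K (rsubmx y).

Lemma bilin_sym y w : bilin A y w = bilin A w y.
Proof.
rewrite /bilin -{1}A_sym -[in LHS](trmxK y) -!trmx_mul mulmxA.
by rewrite mxE.
Qed.

Lemma pdy_split_energy_lshift i y :
  pdy (lshift n2 i) (energy F) x y = 2 * bilin A (delta_mx 0 i) (lsubmx y).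
Proof.
(* [A i i] is the coefficient of [h ^+ 2]; symmetry of [A] merges the two linear terms. *)
apply: (@derive_of_quadratic _ _ _ _ _ _ (A i i)) => h.
rewrite !F_split !line_shiftE !(bilinDl, bilinDr, bilinZl, bilinZr) bilin_delta.
by rewrite (bilin_sym (lsubmx y)); ring.
Qed.

(** The [A] part cancels in the difference quotient, so the quotients of the energy and of [K] are
    the same function of [h]. *)
Lemma pdy_split_energy_rshift i y :
  pdy (rshift n1 i) (energy F) x y = 'D_(delta_mx 0 i) K (rsubmx y).
Proof.
have /funext E :
    (fun h : R => h^-1 *: ((energy F x \o shift y) (h *: delta_mx 0 (rshift n1 i))
                           - energy F x y))
    =1 (fun h => h^-1 *: ((K \o shift (rsubmx y)) (h *: delta_mx 0 i) - K (rsubmx y))).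
  by move=> h /=; rewrite !F_split !line_shiftE opprD addrACA subrr add0r.
by rewrite /pdy /derive E.
Qed.

(** Each first derivative involves only its own fibre component, so the mixed second derivatives
    vanish; those of the quadratic part give [2 * A i j]. *)
Lemma fund_tensor_split_energy y :
  fund_tensor F x y = block_mx A 0 0
    (\matrix_(i, j) (2^-1 * 'D_(delta_mx 0 i) ('D_(delta_mx 0 j) K) (rsubmx y))).
Proof.
apply/matrixP => a b; rewrite -(fintype.splitK a) -(fintype.splitK b).
case: (fintype.split a) => i; case: (fintype.split b) => j /=;
  rewrite ?(block_mxEul, block_mxEur, block_mxEdl, block_mxEdr) !mxE.
- rewrite [X in _ * X](_ : _ = 2 * A i j) ?mulKf ?pnatr_eq0 //.
  apply: (@derive_of_quadratic _ _ _ _ _ _ 0) => h.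
  rewrite !pdy_split_energy_lshift line_shiftE bilinDr bilinZr.
  by rewrite bilin_sym bilin_delta bilin_sym; ring.
- rewrite [X in _ * X](_ : _ = 0) ?mulr0 //.
  apply: derive_constant_on_line => h.
  by rewrite !pdy_split_energy_rshift line_shiftE.
- rewrite [X in _ * X](_ : _ = 0) ?mulr0 //.
  apply: derive_constant_on_line => h.
  by rewrite !pdy_split_energy_lshift line_shiftE.
- congr (_ * _); apply: near_derive_eq; near=> h.
  by rewrite [LHS]pdy_split_energy_rshift line_shiftE.
Unshelve. all: by end_near. Qed.

End SplitEnergy.

(** * Fibre derivatives of a Finsler energy and its scaling by a constant *)

Section FinslerScaling.
Context {R : realType} {n : nat} {M : manifold R n} (F : finsler M).

Lemma open_neq0 : open [set v : 'rV[R]_n | v != 0].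
Proof.
rewrite (_ : [set v | _] = ~` [set 0]); last first.
  by apply/seteqP; split => v /= /eqP.
by apply: closed_openC; apply: accessible_closed_set1; apply: hausdorff_accessible;
  exact: norm_hausdorff.
Qed.

(** Smoothness of a Finsler norm is stated jointly in position and fibre; the direction [(0, w)]
    moves only the fibre. *)
Lemma derive_fibre (G : 'rV[R]_n * 'rV[R]_n -> R) u v w :
  'D_(0, w) G (u, v) = 'D_w (fun z => G (u, z)) v.
Proof.
apply: near_derive_eq; near=> h.
by congr (G (_, _)); rewrite /= scaler0 add0r.
Unshelve. all: by end_near. Qed.

Lemma derivable_fibre (G : 'rV[R]_n * 'rV[R]_n -> R) u v w :
  derivable G (u, v) (0, w) -> derivable (fun z => G (u, z)) v w.
Proof.
apply: near_derivable_eq; near=> h.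
by congr (G (_, _)); rewrite /= scaler0 add0r.
Unshelve. all: by end_near. Qed.

Lemma finsler_derivable i u v w : cimg (charts i) u -> v != 0 ->
  derivable (F i u) v w.
Proof.
move=> iu v0; apply: (derivable_fibre (G := fun p => F i p.1 p.2)).
by have [_ /(_ (0, w))[dF _]] := fnorm_smooth F i 1; exact: dF.
Qed.

Lemma finsler_derivable2 i u v w w' : cimg (charts i) u -> v != 0 ->
  derivable ('D_w (F i u)) v w'.
Proof.
move=> iu v0.
rewrite (_ : 'D_w (F i u) = fun z => 'D_(0, w) (fun p => F i p.1 p.2) (u, z)); last first.
  by apply/funext => z; rewrite derive_fibre.
apply: (derivable_fibre (G := 'D_(0, w) (fun p => F i p.1 p.2))).
by have [_ /(_ (0, w))[_ [_ /(_ (0, w'))[dF _]]]] := fnorm_smooth F i 2; exact: dF.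
Qed.

Lemma energyM i u : energy (F i) u = F i u * F i u.
Proof. by apply/funext => z; rewrite /energy expr2. Qed.

Lemma derivable_energy i u v w : cimg (charts i) u -> v != 0 ->
  derivable (energy (F i) u) v w.
Proof. by move=> iu v0; rewrite energyM; apply: derivableM; exact: finsler_derivable. Qed.

Lemma derivable_energy2 i u v w w' : cimg (charts i) u -> v != 0 ->
  derivable ('D_w (energy (F i) u)) v w'.
Proof.
move=> iu v0.
have dFF : derivable (F i u * 'D_w (F i u)) v w'.
  by apply: derivableM; [exact: finsler_derivable | exact: finsler_derivable2].
(* The product rule for the inner derivative holds only off zero, which suffices since the line
   stays there for small [h]. *)
apply: near_derivable_eq (derivableD dFF dFF).
apply: filterS (near_line w' open_neq0 v0) => h hv0.
have dF := @finsler_derivable i u _ w iu hv0.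
by rewrite energyM (deriveM dF dF).
Qed.

(** Used with [c] the value of the squared twisting function, constant along the fibre; derivability
    off zero lets it pass through both derivatives. *)
Lemma fund_tensor_scale (c : R) i u v : cimg (charts i) u -> v != 0 ->
  \matrix_(a, b) (2^-1 * 'D_(delta_mx 0 a)
    ('D_(delta_mx 0 b) (fun z => c * F i u z ^+ 2)) v)
  = c *: fund_tensor (F i) u v.
Proof.
move=> iu v0; apply/matrixP => a b; rewrite !mxE mulrCA; congr (_ * _).
rewrite /pdy -[RHS](deriveZ c (@derivable_energy2 i u v (delta_mx 0 b) (delta_mx 0 a) iu v0)).
apply: near_derive_eq.
apply: filterS (near_line (delta_mx 0 a) open_neq0 v0) => h hv0.
exact: (deriveZ c (@derivable_energy i u _ (delta_mx 0 b) iu hv0)).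
Qed.

End FinslerScaling.

(** * Reading the curvature of the first factor from that of the product *)

Theorem theorem3 (R : realType) (n1 n2 : nat) (hn1 : (0 < n1)%N) (hn2 : (0 < n2)%N)
  (M1 : manifold R n1) (M2 : manifold R n2)
  (F1 : finsler M1) (F2 : finsler M2)
  (f : M1 * M2 -> R) (f_gt0 : forall p, 0 < f p) (f_smooth : smooth_function f)
  (F_flat : flat_twisted_product F1 F2 f)
  (g1 : riemannian_metric M1) (F1_riemannian : is_riemannian F1 g1)
  (f_M2 : depends_on_second_only f) :
  locally_flat g1.
Proof.
move=> i x ix a b c d.
(* Flatness is evaluated over [x] at an auxiliary point of [M2], with all-ones fibre vectors,
   nonzero because both dimensions are positive. *)
have [p _] := space_nonempty M2; have [j jp] := charts_cover p.
pose u := cmap (charts j) p; have ju : cimg (charts j) u := cmap_img jp.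
pose y : 'rV[R]_n1 := const_mx 1; pose v : 'rV[R]_n2 := const_mx 1.
have y0 : y != 0.
  by apply/eqP => /rowP/(_ a)/eqP; rewrite !mxE oner_eq0.
have v0 : v != 0.
  by apply/eqP => /rowP/(_ (Ordinal hn2))/eqP; rewrite !mxE oner_eq0.
pose F := twisted_norm F1 F2 f i j.
pose U1 := cimg (charts i); pose U2 := cimg (charts j).
pose V2 := [set v : 'rV[R]_n2 | v != 0].
pose phi (x : 'rV[R]_(n1 + n2)) := local_expr f i j (lsubmx x) (rsubmx x) ^+ 2.
pose g2 (x y : 'rV[R]_(n1 + n2)) :=
  phi x *: fund_tensor (F2 j) (rsubmx x) (rsubmx y).
have F_block x' y' : split_domain U1 U2 V2 x' y' ->
    fund_tensor F x' y' = block_mx (g1 i (lsubmx x')) 0 0 (g2 x' y').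
  move=> [Ux Uu Vv]; rewrite /g2 -fund_tensor_scale //.
  apply: fund_tensor_split_energy; first exact: rmetric_sym.
  move=> z; rewrite /energy sqr_sqrtr; last first.
    by rewrite addr_ge0 ?sqr_ge0 // -exprMn sqr_ge0.
  congr (_ + _); rewrite F1_riemannian // sqr_sqrtr //.
  (* Positive definiteness covers only nonzero vectors, while the splitting is needed for every
     fibre vector. *)
  have [->|z0] := eqVneq (lsubmx z) 0; first by rewrite /bilin !mul0mx mxE.
  exact/ltW/rmetric_posdef.
have F_unit x' y' : split_domain U1 U2 V2 x' y' -> fund_tensor F x' y' \in unitmx.
  move=> D; have [Ux Uu Vv] := D.
  (* The determinant is the product of those of the two blocks, both invertible by positive
     definiteness and [f_gt0]. *)
  rewrite F_block // unitmxE det_lblock unitrM -!unitmxE; apply/andP; split.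
    by apply: posdef_unitmx => w; exact: rmetric_posdef.
  rewrite unitmxZ ?unitfE ?expf_neq0 ?gt_eqF ?f_gt0 //.
  by apply: posdef_unitmx => w; exact: fnorm_posdef.
have Dxy : split_domain U1 U2 V2 (row_mx x u) (row_mx y v).
  by split; rewrite ?row_mxKl ?row_mxKr.
have <- : hcurv F (lshift n2 a) (lshift n2 b) (lshift n2 c) (lshift n2 d)
    (row_mx x u) (row_mx y v) = riemann_curv (g1 i) a b c d x.
  rewrite -[in RHS](row_mxKl x u).
  apply: (hcurv_base (U1 := U1) (U2 := U2) (V2 := V2) (g2 := g2)) => //.
  - exact: cimg_open.
  - exact: cimg_open.
  - exact: open_neq0.
exact: F_flat.
Qed.
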